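(* Let $f_1, f_2 \colon \mathbb{Z} \to \mathbb{C}$ be functions. Then $$f_1(u+v)\, f_2(u-v)\, f_1(u'+v')\, f_2(u'-v') = f_1(u+v')\, f_2(u-v')\, f_1(u'+v)\, f_2(u'-v)$$ holds for all $u,u',v,v' \in \mathbb{Z}$ if and only if at least one of the following conditions holds: (1) $f_1 \equiv 0$. (2) $f_2 \equiv 0$. (3) There exists $a \in \mathbb{Z}$ such that $\operatorname{supp} f_1 = \{a\}$ and $\#(\operatorname{supp} f_2 \cap (a + 2\mathbb{Z})) = 1$. (4) There exists $a \in \mathbb{Z}$ such that $\operatorname{supp} f_2 = \{a\}$ and $\#(\operatorname{supp} f_1 \cap (a + 2\mathbb{Z})) = 1$. (5) There exists $a \in \mathbb{Z}$ such that $\operatorname{supp} f_1 \subset a + 2\mathbb{Z}$ and $\operatorname{supp} f_2 \subset a + 1 + 2\mathbb{Z}$. (6) There exist $a_1, a_2, k \in \mathbb{Z}$ with $k \in 1 + 2\mathbb{Z}$ and $a_1 + a_2 \in 1 + 2\mathbb{Z}$ such that $\operatorname{supp} f_1 \subset \{a_1, a_1 - k, a_1 + k\}$, $\operatorname{supp} f_2 \subset \{a_2, a_2 - k, a_2 + k\}$, and $$f_1(a_1)^2 f_2(a_2-k) f_2(a_2+k) = f_2(a_2)^2 f_1(a_1-k) f_1(a_1+k).$$ (7) There exist $c_1,c_2,c_3,c_4,c_5,c_6 \in \mathbb{C}$, a positive odd integer $k$, and $a_1,a_2 \in \mathbb{Z}$ with $a_1+a_2 \in 2\mathbb{Z}$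 such that $$f_1(u) = \begin{cases} e^{c_1u^2 + c_2(-1)^u + c_3u + c_4} & \text{if } u \in a_1 + k\mathbb{Z}, \\ 0 & \text{if } u \notin a_1 + k\mathbb{Z}, \end{cases} \qquad f_2(u) = \begin{cases} e^{c_1u^2 - c_2(-1)^u + c_5u + c_6} & \text{if } u \in a_2 + k\mathbb{Z}, \\ 0 & \text{if } u \notin a_2 + k\mathbb{Z}. \end{cases}$$
   Context: For $f \colon \mathbb{Z} \to \mathbb{C}$, $\operatorname{supp} f := \{u \in \mathbb{Z} \mid f(u) \neq 0\}$. The number of elements of a set $S$ is denoted $\# S$. *)

(* Defs.v *)
From Stdlib Require Export Reals ZArith Ensembles Finite_sets.
From Coquelicot Require Export Complex.

Definition supp (f : Z -> C) : Ensemble Z := fun u => f u <> RtoC 0.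

Definition coset (a k : Z) : Ensemble Z := fun u => exists n : Z, u = (a + k * n)%Z.

(* Coquelicot has no complex exponential:
   e^(x + i y) = e^x (cos y + i sin y). *)
Definition Cexp (z : C) : C :=
  ((exp (Re z) * cos (Im z))%R, (exp (Re z) * sin (Im z))%R).

Definition Csign (u : Z) : C := RtoC (powerRZ (-1) u).

(* Main.v *)
Require Import Defs.
From Stdlib Require Import Reals ZArith Ensembles Finite_sets.
From Coquelicot Require Import Complex.
From Stdlib Require Import Classical Lia Lra.

(** The equation says that F(u,v) = f1(u+v) f2(u-v) is a matrix all of whose 2 x
    2 minors vanish, that is, a matrix of rank at most 1.

    The support of a matrix of rank at most 1 is a product set. In terms of A =
    supp f1 and B = supp f2 this is the relation [exchange A B], and most of the
    classification happens at the level of these two sets. If no point of A is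
    congruent mod 2 to a point of B, the parities are separated. If A = {a} and
    B has some point of the parity of a, it has only one, since otherwise half
    the difference of two of them would translate a to another point of A; the
    same holds with A and B exchanged. In the remaining case both sets have at
    least two points, and all pairs of parities occur ([other_parity]). Let g be
    the least distance between two points of A or between two points of B. It is
    odd, since an even distance could be halved. Pairing a gap g with a longer
    gap e of the other set cuts the longer one into pieces (e-g)/2, g, (e-g)/2,
    so by induction on e both sets are intervals of arithmetic progressions of
    difference g ([chain_between]). If one of them contains four consecutive
    terms, then both parities contain a gap 2g, the other set is invariant under
    translation by g, hence has four consecutive terms too, and both are full
    cosets of gZ. Otherwise each has at most three terms, and these fit into two
    triples of step g. All this is [exchange_structure].

    It remains to read off the values. The minor at two points of opposite
    parity, [satisfies_cross], is the equation required on triples. On full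
    cosets the same minor says that the second multiplicative difference f(u+g)
    f(u-g) / f(u)^2 of f1 at x equals that of f2 at y whenever x + y is odd. So
    it depends on the parity of u only, with the two values exchanged between f1
    and f2. The exponential of c1 u^2 + c2 (-1)^u + c3 u + c4 has second
    difference exp (2 c1 g^2 - 4 c2 (-1)^u), so c1 and c2 can be fitted to the
    two values, c3 and c4 to the values of f at two consecutive points, and the
    two sequences agree since they solve the same second order recurrence
    ([quadratic_exponential]).

    Conversely, by symmetry, the equation need only be checked where its left
    hand side is nonzero ([satisfies_on_supp]). Separated parities leave no such
    point. For singletons both sides have the same factors; for triples there is
    in addition the minor that is assumed to vanish. Otherwise f1 and f2 are
    exponentials on cosets, for which F(u,v) visibly splits into a function of u
    and a function of v. *)

(** * Supports: the exchange relation *)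

Local Open Scope Z_scope.

(** Closes a goal [P x] with a hypothesis [P y] when x = y is linear
    arithmetic. *)
Ltac same_point H :=
  let t := type of H in
  match t with
  | ?P ?y => match goal with |- P ?x => replace x with y by lia; exact H end
  end.

(** With P = {(u,v) | A (u+v) and B (u-v)}: if (u,v) and (u',v') are in P, so is
    (u,v').  This means that P is a product set; that (u',v) is in P as well
    follows by exchanging the two points. *)
Definition exchange (A B : Z -> Prop) : Prop :=
  forall u u' v v', A (u + v) -> B (u - v) -> A (u' + v') -> B (u' - v') ->
  A (u + v') /\ B (u - v').

Lemma exchange_sym A B : exchange A B -> exchange B A.
Proof.
intros H u u' v v' h1 h2 h3 h4.
destruct (H u u' (- v) (- v')) as [h5 h6].
- same_point h2.
- same_point h1.
- same_point h4.
- same_point h3.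
- split; [same_point h6 | same_point h5].
Qed.

(** The relation in the coordinates x = u + v, y = u - v: the corner (u,v') is
    (x + p, y - p). *)
Lemma exchange_points A B x y x' y' p r :
  exchange A B -> A x -> B y -> A x' -> B y' ->
  x - y = 2 * r -> (x' - x) - (y' - y) = 2 * p ->
  A (x + p) /\ B (y - p).
Proof.
intros H hx hy hx' hy' e1 e2.
destruct (H (y + r) (y' + r + p) r (r + p)) as [h1 h2].
- same_point hx.
- same_point hy.
- same_point hx'.
- same_point hy'.
- split; [same_point h1 | same_point h2].
Qed.

(** The case x' = x of [exchange_points], for both orders of the two points of
    B. *)
Lemma exchange_midpoint A B x y m r :
  exchange A B -> A x -> B y -> B (y + 2 * m) -> x - y = 2 * r ->
  A (x + m) /\ A (x - m) /\ B (y + m).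
Proof.
intros H hx hy hy' e.
destruct (exchange_points A B x y x (y + 2 * m) (- m) r) as [h1 h2];
  auto; try lia.
destruct (exchange_points A B x (y + 2 * m) x y m (r - m)) as [h3 h4];
  auto; try lia.
split; [same_point h3|split; [same_point h1 | same_point h2]].
Qed.

(** Halving an even gap 2m of B at its midpoint leads to a gap whose half is
    odd; the midpoint and the translate of x by that half then have the other
    parity. *)
Lemma other_parity_of_gap A B m : exchange A B -> 0 < m ->
  forall x y r, A x -> B y -> B (y + 2 * m) -> x - y = 2 * r ->
  exists x1 y1 s t, A x1 /\ B y1 /\ x1 - x = 2 * s + 1 /\ y1 - y = 2 * t + 1.
Proof.
intros H hm; assert (hm0 : 0 <= m) by lia; revert hm.
pattern m; apply Zlt_0_ind; [|exact hm0].
clear m hm0; intros m IH _ hm x y r hx hy hy' e.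
destruct (exchange_midpoint A B x y m r) as (h1 & h2 & h3); auto.
destruct (Z.Even_or_Odd m) as [[k ek]|[k ek]].
- apply (IH k ltac:(lia) ltac:(lia) x y r); auto.
  same_point h3.
- exists (x + m), (y + m), k, k; repeat split; auto; lia.
Qed.

(** If some extra point of A or of B has the parity of x, the previous lemma
    applies; if both have the other parity, they are the pair looked for. *)
Lemma other_parity A B x y r x' y' : exchange A B ->
  A x -> B y -> x - y = 2 * r -> A x' -> x' <> x -> B y' -> y' <> y ->
  exists x1 y1 s t, A x1 /\ B y1 /\ x1 - x = 2 * s + 1 /\ y1 - y = 2 * t + 1.
Proof.
intros H hx hy e hx' nx hy' ny.
assert (hB : forall m z, 0 < m -> B z -> B (z + 2 * m) -> (exists r, z - y = 2 * r) ->
  exists x1 y1 s t, A x1 /\ B y1 /\ x1 - x = 2 * s + 1 /\ y1 - y = 2 * t + 1).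
{ intros m z hm hz hz' [q eq].
  destruct (other_parity_of_gap A B m H hm x z (r - q))
    as (x1 & y1 & s & t & h1 & h2 & h3 & h4); auto; try lia.
  exists x1, y1, s, (t + q); repeat split; auto; lia. }
assert (hA : forall m z, 0 < m -> A z -> A (z + 2 * m) -> (exists r, z - x = 2 * r) ->
  exists x1 y1 s t, A x1 /\ B y1 /\ x1 - x = 2 * s + 1 /\ y1 - y = 2 * t + 1).
{ intros m z hm hz hz' [q eq].
  destruct (other_parity_of_gap B A m (exchange_sym A B H) hm y z (- r - q))
    as (x1 & y1 & s & t & h1 & h2 & h3 & h4); auto; try lia.
  exists y1, x1, (t + q), s; repeat split; auto; lia. }
destruct (Z.Even_or_Odd (y' - y)) as [[m em]|[m em]].
- destruct (Z_lt_le_dec 0 m).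
  + apply (hB m y); auto; [same_point hy' | exists 0; lia].
  + apply (hB (- m) y'); auto; [lia | same_point hy | exists m; lia].
- destruct (Z.Even_or_Odd (x' - x)) as [[n en]|[n en]].
  + destruct (Z_lt_le_dec 0 n).
    * apply (hA n x); auto; [same_point hx' | exists 0; lia].
    * apply (hA (- n) x'); auto; [lia | same_point hx | exists n; lia].
  + exists x', y', n, m; auto.
Qed.

(** * Supports: intervals of arithmetic progressions *)

Definition gap (A : Z -> Prop) (h : Z) : Prop := exists x, A x /\ A (x + h).

Lemma gap_of_distinct (A : Z -> Prop) x x' : A x -> A x' -> x' <> x ->
  exists h, 0 < h /\ gap A h.
Proof.
intros hx hx' n; destruct (Z_lt_le_dec x x').
- exists (x' - x); split; [lia|exists x; split; auto; same_point hx'].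
- exists (x - x'); split; [lia|exists x'; split; auto; same_point hx].
Qed.

Lemma least_positive (P : Z -> Prop) h : 0 < h -> P h ->
  exists g, 0 < g /\ P g /\ forall k, 0 < k < g -> ~ P k.
Proof.
intros hh; assert (h0 : 0 <= h) by lia; revert hh.
pattern h; apply Zlt_0_ind; [|exact h0].
clear h h0; intros h IH _ hh Ph.
destruct (classic (exists k, 0 < k < h /\ P k)) as [(k & hk & Pk)|N].
- apply (IH k); auto; lia.
- exists h; repeat split; auto; intros k hk Pk; apply N; exists k; auto.
Qed.

(** The heart of the classification, by induction on the length e of a segment
    with end points in B.  An even e is cut at its midpoint.  An odd e is paired
    with the segment [x0, x0 + g] of A, end points of equal parity together; the
    two other corners of the resulting rectangle are in B at distance (e-g)/2
    from either end, so that they are themselves g apart. *)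
Lemma chain_between A B x0 g t :
  exchange A B -> A x0 -> A (x0 + g) -> 0 < g -> g = 2 * t + 1 ->
  (forall h, 0 < h < g -> ~ gap B h) ->
  forall e, 0 <= e -> forall y, B y -> B (y + e) ->
  exists n, 0 <= n /\ e = g * n /\ forall j, 0 <= j <= n -> B (y + g * j).
Proof.
intros H hx hx' hg og min e he; pattern e; apply Zlt_0_ind; [|exact he].
clear e he; intros e IH he y hy hy'.
destruct (Z.eq_dec e 0) as [->|ne].
{ exists 0; repeat split; try lia; intros j hj; same_point hy. }
assert (hge : g <= e).
{ destruct (Z_lt_le_dec e g) as [h|h]; auto.
  exfalso; apply (min e); [lia|exists y; auto]. }
destruct (Z.Even_or_Odd e) as [[m em]|[p0 ep]].
- assert (hm : B (y + m)).
  { assert (hy2 : B (y + 2 * m)) by same_point hy'.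
    destruct (Z.Even_or_Odd (x0 - y)) as [[q eq]|[q eq]].
    - apply (exchange_midpoint A B x0 y m q); auto.
    - apply (exchange_midpoint A B (x0 + g) y m (q + t + 1)); auto; lia. }
  destruct (IH m ltac:(lia) y) as (n1 & h1 & h2 & h3); auto.
  destruct (IH m ltac:(lia) (y + m)) as (n2 & h4 & h5 & h6); auto.
  { same_point hy'. }
  exists (n1 + n2); repeat split; [lia|lia|].
  intros j hj; destruct (Z_le_gt_dec j n1).
  + apply h3; lia.
  + generalize (h6 (j - n1) ltac:(lia)); intros h7; same_point h7.
- set (p := p0 - t).
  assert (hp : B (y + p) /\ B (y + p + g)).
  { unfold p; destruct (Z.Even_or_Odd (x0 - y)) as [[q eq]|[q eq]].
    - destruct (exchange_points A B x0 y (x0 + g) (y + e) (t - p0) q)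
        as [_ h1]; auto; try lia.
      destruct (exchange_points A B (x0 + g) (y + e) x0 y (p0 - t) (q + t - p0))
        as [_ h2]; auto; try lia.
      split; [same_point h1|same_point h2].
    - destruct (exchange_points A B (x0 + g) y x0 (y + e) (- t - p0 - 1) (q + t + 1))
        as [_ h1]; auto; try lia.
      destruct (exchange_points A B x0 (y + e) (x0 + g) y (t + p0 + 1) (q - p0))
        as [_ h2]; auto; try lia.
      split; [same_point h2|same_point h1]. }
  destruct hp as [hp1 hp2].
  destruct (IH p ltac:(lia) y) as (n1 & h1 & h2 & h3); auto.
  destruct (IH p ltac:(lia) (y + p + g)) as (n2 & h4 & h5 & h6); auto.
  { same_point hy'. }
  exists (n1 + 1 + n2); repeat split; [lia|lia|].
  intros j hj; destruct (Z_le_gt_dec j n1).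
  + apply h3; lia.
  + generalize (h6 (j - n1 - 1) ltac:(lia)); intros h7; same_point h7.
Qed.

(** A is an interval of a residue class mod g (when g is positive). *)
Definition chained (A : Z -> Prop) (g : Z) : Prop :=
  forall x x', A x -> A x' -> x <= x' ->
  exists n, 0 <= n /\ x' = x + g * n /\ forall j, 0 <= j <= n -> A (x + g * j).

Definition chain3 (A : Z -> Prop) (g : Z) : Prop :=
  exists a, A (a - g) /\ A a /\ A (a + g).

Definition chain4 (A : Z -> Prop) (g : Z) : Prop :=
  exists a, A (a - g) /\ A a /\ A (a + g) /\ A (a + 2 * g).

Lemma chained_chain3 A g a : chained A g -> 0 < g ->
  A (a - g) -> A a -> A (a + g) -> ~ chain4 A g ->
  Included Z A (Triple Z a (a - g) (a + g)).
Proof.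
intros C hg h1 h2 h3 N z hz; unfold In in hz.
destruct (Z_le_gt_dec a z) as [h|h].
- destruct (C a z) as (n & hn & en & hc); auto.
  assert (n < 2).
  { destruct (Z_lt_le_dec n 2); auto; exfalso; apply N.
    exists a; repeat split; auto.
    generalize (hc 2 ltac:(lia)); intros h4; same_point h4. }
  assert (hn' : n = 0 \/ n = 1) by lia; destruct hn' as [-> | ->].
  + replace z with a by lia; apply Triple_l.
  + replace z with (a + g) by lia; apply Triple_r.
- destruct (C z a) as (n & hn & en & hc); auto; try lia.
  assert (n < 2).
  { destruct (Z_lt_le_dec n 2); auto; exfalso; apply N.
    (* z + g * (n - 2) = a - 2g *)
    exists (a - g).
    generalize (hc (n - 2) ltac:(lia)); intros h4.
    repeat split; [same_point h4|same_point h1|same_point h2|same_point h3]. }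
  assert (hn' : n = 0 \/ n = 1) by lia; destruct hn' as [-> | ->].
  + lia.
  + replace z with (a - g) by lia; apply Triple_m.
Qed.

Lemma chained_pair A g a : chained A g -> 0 < g ->
  A a -> A (a + g) -> ~ chain3 A g -> forall z, A z -> z = a \/ z = a + g.
Proof.
intros C hg h1 h2 N z hz.
destruct (Z_le_gt_dec a z) as [h|h].
- destruct (C a z) as (n & hn & en & hc); auto.
  assert (n < 2).
  { destruct (Z_lt_le_dec n 2); auto; exfalso; apply N.
    exists (a + g); repeat split; auto; [same_point h1|].
    generalize (hc 2 ltac:(lia)); intros h4; same_point h4. }
  assert (hn' : n = 0 \/ n = 1) by lia; destruct hn' as [-> | ->]; lia.
- destruct (C z a) as (n & hn & en & hc); auto; try lia.
  assert (0 < n) by (destruct (Z.eq_dec n 0) as [->|]; lia).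
  exfalso; apply N; exists a; repeat split; auto.
  generalize (hc (n - 1) ltac:(lia)); intros h4; same_point h4.
Qed.

(** A chain of four contains gaps 2g of both parities, one of which can be
    halved against x. *)
Lemma chain4_translates A B g t : exchange A B -> g = 2 * t + 1 -> chain4 B g ->
  forall x, A x -> A (x - g) /\ A (x + g).
Proof.
intros H og (a & h1 & h2 & h3 & h4) x hx.
destruct (Z.Even_or_Odd (x - a)) as [[q eq]|[q eq]].
- destruct (exchange_midpoint A B x a g q) as (h5 & h6 & _); auto.
- destruct (exchange_midpoint A B x (a - g) g (q + t + 1)) as (h5 & h6 & _);
    auto; try lia.
  same_point h3.
Qed.

Lemma translates_chain4 (A : Z -> Prop) g x :
  A x -> (forall x, A x -> A (x - g) /\ A (x + g)) -> chain4 A g.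
Proof.
intros hx S; exists x; repeat split; auto; try apply S; auto.
replace (x + 2 * g) with (x + g + g) by lia.
apply S, S, hx.
Qed.

Lemma translates_coset A g x0 : chained A g -> A x0 ->
  (forall x, A x -> A (x - g) /\ A (x + g)) -> forall x, A x <-> coset x0 g x.
Proof.
intros C h0 S x; split.
- intros hx; destruct (Z_le_gt_dec x0 x) as [h|h].
  + destruct (C x0 x) as (n & _ & e & _); auto; exists n; lia.
  + destruct (C x x0) as (n & _ & e & _); auto; try lia; exists (- n); lia.
- intros [n ->]; revert n; apply Z.peano_ind.
  + same_point h0.
  + intros n hn; destruct (S _ hn) as [_ h]; same_point h.
  + intros n hn; destruct (S _ hn) as [h _]; same_point h.
Qed.

(** The two shapes left when both supports have at least two points.  The parity
    of a1 + a2 matters only for the triples; for cosets of an odd g it can be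
    adjusted by [coset_shift]. *)
Definition triples_or_cosets (A B : Z -> Prop) (g : Z) : Prop :=
  exists a1 a2,
    ((exists s, a1 + a2 = 2 * s + 1) /\
     Included Z A (Triple Z a1 (a1 - g) (a1 + g)) /\
     Included Z B (Triple Z a2 (a2 - g) (a2 + g))) \/
    ((exists s, a1 + a2 = 2 * s) /\
     (forall x, A x <-> coset a1 g x) /\ (forall y, B y <-> coset a2 g y)).

Lemma triples_or_cosets_sym A B g :
  triples_or_cosets B A g -> triples_or_cosets A B g.
Proof.
intros (a1 & a2 & [((s & e) & h1 & h2)|((s & e) & h1 & h2)]);
exists a2, a1; [left|right]; repeat split; auto;
  try (exists s; lia); try apply h1; try apply h2.
Qed.

Lemma coset_shift a g x : coset a g x <-> coset (a + g) g x.
Proof. split; intros [n ->]; [exists (n - 1)|exists (n + 1)]; lia. Qed.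

Lemma cosets_of_chain4 A B g t x0 y0 : exchange A B -> chained A g -> chained B g ->
  g = 2 * t + 1 -> A x0 -> B y0 -> chain4 B g -> triples_or_cosets A B g.
Proof.
intros H CA CB og hx hy h4.
assert (SA := chain4_translates A B g t H og h4).
assert (SB := chain4_translates B A g t (exchange_sym A B H) og
                (translates_chain4 A g x0 hx SA)).
assert (hA := translates_coset A g x0 CA hx SA).
assert (hB := translates_coset B g y0 CB hy SB).
destruct (Z.Even_or_Odd (x0 + y0)) as [[s e]|[s e]].
- exists x0, y0; right; repeat split; try apply hA; try apply hB; exists s; lia.
- exists x0, (y0 + g); right; split; [exists (s + t + 1); lia|split; auto].
  intros y; rewrite <- coset_shift; auto.
Qed.

(** Only the set A needs to be known to have three terms: its end points have a
    common parity, so half of their distance, which is g, translates any point b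
    of B of that parity both ways.  Thus b is the middle of a chain of three in
    B. *)
Lemma triples_of_chain3 A B g t y0 : exchange A B -> chained A g -> chained B g ->
  0 < g -> g = 2 * t + 1 -> B y0 -> B (y0 + g) ->
  ~ chain4 A g -> ~ chain4 B g -> chain3 A g -> triples_or_cosets A B g.
Proof.
intros H CA CB hg og hy hy' NA NB (a & h1 & h2 & h3).
assert (hb : exists b s, B b /\ a + b = 2 * s + 1).
{ destruct (Z.Even_or_Odd (a + y0)) as [[s e]|[s e]].
  - exists (y0 + g), (s + t); split; auto; lia.
  - exists y0, s; auto. }
destruct hb as (b & s & hb & e).
destruct (exchange_midpoint B A b (a - g) g (s - a + t + 1)) as (h4 & h5 & _);
  auto using exchange_sym; try lia.
{ same_point h3. }
exists a, b; left; split; [exists s; auto|].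
split; apply chained_chain3; auto.
Qed.

(** The least gap g exists by well-ordering and may be assumed to occur in A.  A
    point of B of the right parity shows that g is odd, and then
    [chain_between] applies first to B, which therefore also has a gap g, and
    then to A. *)
Lemma exchange_structure A B x y r x' y' : exchange A B ->
  A x -> B y -> x - y = 2 * r -> A x' -> x' <> x -> B y' -> y' <> y ->
  exists g, 0 < g /\ coset 1 2 g /\ triples_or_cosets A B g.
Proof.
intros H hx hy e hx' nx hy' ny.
destruct (other_parity A B x y r x' y')
  as (x1 & y1 & s & t & hx1 & hy1 & ex & ey); auto.
assert (hA : forall z, exists w q, A w /\ w - z = 2 * q).
{ intros z; destruct (Z.Even_or_Odd (x - z)) as [[q eq]|[q eq]].
  - exists x, q; auto.
  - exists x1, (q + s + 1); split; auto; lia. }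
assert (hB : forall z, exists w q, B w /\ w - z = 2 * q).
{ intros z; destruct (Z.Even_or_Odd (y - z)) as [[q eq]|[q eq]].
  - exists y, q; auto.
  - exists y1, (q + t + 1); split; auto; lia. }
assert (hg : exists g, 0 < g /\ (gap A g \/ gap B g) /\
               forall k, 0 < k < g -> ~ (gap A k \/ gap B k)).
{ destruct (gap_of_distinct A x x') as (h & h0 & h1); auto.
  apply (least_positive (fun g => gap A g \/ gap B g) h); auto. }
clear x y r x' y' hx hy e hx' nx hy' ny x1 y1 s t hx1 hy1 ex ey.
destruct hg as (g & hg & hgap & min).
assert (minA : forall k, 0 < k < g -> ~ gap A k) by
  (intros k hk h; apply (min k); auto).
assert (minB : forall k, 0 < k < g -> ~ gap B k) by
  (intros k hk h; apply (min k); auto).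
clear min; exists g; split; auto.
(* all hypotheses but the place of the gap are symmetric in A and B *)
revert A B H hA hB hgap minA minB.
enough (W : forall A B : Z -> Prop, exchange A B ->
  (forall z, exists w q, A w /\ w - z = 2 * q) ->
  (forall z, exists w q, B w /\ w - z = 2 * q) -> gap A g ->
  (forall k, 0 < k < g -> ~ gap A k) -> (forall k, 0 < k < g -> ~ gap B k) ->
  coset 1 2 g /\ triples_or_cosets A B g).
{ intros A B H hA hB [G|G] minA minB; [auto|].
  destruct (W B A) as [h1 h2]; auto using exchange_sym, triples_or_cosets_sym. }
intros A B H hA hB [x [hx hx']] minA minB.
assert (hg2 : exists t, g = 2 * t + 1).
{ destruct (Z.Even_or_Odd g) as [[m em]|og]; [exfalso|exact og].
  apply (minA m); [lia|].
  destruct (hB x) as (y & q & hy & ey).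
  destruct (exchange_midpoint B A y x m q) as (_ & _ & h);
    auto using exchange_sym.
  - same_point hx'.
  - exists x; auto. }
destruct hg2 as [t og].
split; [exists t; lia|].
assert (CB : chained B g).
{ intros y y' hy hy' le.
  destruct (chain_between A B x g t) with (e := y' - y) (y := y)
    as (n & h1 & h2 & h3); auto; try lia; [same_point hy'|].
  exists n; repeat split; auto; lia. }
destruct (hB 0) as (y & q & hy & ey).
destruct (hB 1) as (y' & q' & hy' & ey').
assert (hgB : exists y, B y /\ B (y + g)).
{ assert (hlt : exists y y', B y /\ B y' /\ y < y').
  { destruct (Z_lt_le_dec y y'); [exists y, y'|exists y', y]; repeat split; auto; lia. }
  clear y q hy ey y' q' hy' ey'; destruct hlt as (y & y' & hy & hy' & lt).
  destruct (CB y y') as (n & hn & e & hc); auto; [lia|].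
  exists y; split; auto.
  assert (n <> 0) by (intros ->; lia).
  generalize (hc 1 ltac:(lia)); intros h; same_point h. }
clear y q hy ey y' q' hy' ey'; destruct hgB as (y & hy & hy').
assert (CA : chained A g).
{ intros z z' hz hz' le.
  destruct (chain_between B A y g t) with (e := z' - z) (y := z)
    as (n & h1 & h2 & h3); auto using exchange_sym; try lia; [same_point hz'|].
  exists n; repeat split; auto; lia. }
destruct (classic (chain4 B g)) as [B4|B4].
{ apply (cosets_of_chain4 A B g t x y); auto. }
destruct (classic (chain4 A g)) as [A4|A4].
{ apply triples_or_cosets_sym, (cosets_of_chain4 B A g t y x);
    auto using exchange_sym. }
destruct (classic (chain3 A g)) as [A3|A3].
{ apply (triples_of_chain3 A B g t y); auto. }
destruct (classic (chain3 B g)) as [B3|B3].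
{ apply triples_or_cosets_sym, (triples_of_chain3 B A g t x);
    auto using exchange_sym. }
assert (pA := chained_pair A g x CA hg hx hx' A3).
assert (pB := chained_pair B g y CB hg hy hy' B3).
destruct (Z.Even_or_Odd (x + y)) as [[s e]|[s e]].
- exists x, (y + g); left; split; [exists (s + t); lia|split].
  + intros z hz; destruct (pA z hz) as [-> | ->]; [apply Triple_l|apply Triple_r].
  + intros z hz; destruct (pB z hz) as [-> | ->]; [|apply Triple_l].
    generalize (Triple_m Z (y + g) (y + g - g) (y + g + g)).
    replace (y + g - g) with y by lia; auto.
- exists x, y; left; split; [exists s; auto|split].
  + intros z hz; destruct (pA z hz) as [-> | ->]; [apply Triple_l|apply Triple_r].
  + intros z hz; destruct (pB z hz) as [-> | ->]; [apply Triple_l|apply Triple_r].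
Qed.

(** * The complex exponential and the sign character *)

Lemma Cexp_plus z w : Cexp (z + w)%C = (Cexp z * Cexp w)%C.
Proof.
destruct z, w; unfold Cexp, Cmult, Cplus; cbn; rewrite exp_plus, cos_plus, sin_plus.
f_equal; ring.
Qed.

Lemma Cexp_sq z : (Cexp z ^ 2)%C = Cexp (z + z).
Proof. rewrite Cexp_plus; ring. Qed.

Lemma Cexp_neq_0 z : Cexp z <> RtoC 0.
Proof.
intros h.
assert (h1 : (Cexp z * Cexp (- z))%C = RtoC 1).
{ rewrite <- Cexp_plus; replace (z + - z)%C with (RtoC 0) by ring.
  unfold Cexp, RtoC; cbn; rewrite exp_0, cos_0, sin_0; f_equal; ring. }
rewrite h, Cmult_0_l in h1; injection h1; lra.
Qed.

Lemma unit_circle x y : (x * x + y * y = 1)%R ->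
  exists t, cos t = x /\ sin t = y.
Proof.
intros h.
assert (hx : (-1 <= x <= 1)%R) by nra.
assert (hs : sqrt (1 - Rsqr x) = Rabs y).
{ rewrite <- sqrt_Rsqr_abs; f_equal; unfold Rsqr; lra. }
destruct (Rle_dec 0 y) as [hy|hy].
- exists (acos x); rewrite cos_acos, sin_acos, hs, Rabs_pos_eq; auto.
- exists (- acos x)%R; rewrite cos_neg, sin_neg, cos_acos, sin_acos, hs, Rabs_left;
    auto; lra.
Qed.

Lemma Cexp_surjective z : z <> RtoC 0 -> exists w, Cexp w = z.
Proof.
intros hz.
assert (hr : (0 < Cmod z)%R) by (apply Cmod_gt_0; exact hz).
destruct z as [x y].
assert (e : (Cmod (x, y) * Cmod (x, y) = x * x + y * y)%R).
{ unfold Cmod; rewrite sqrt_sqrt; cbn; [ring|nra]. }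
set (r := Cmod (x, y)) in *.
destruct (unit_circle (x / r) (y / r)) as (t & hc & hs).
{ field_simplify; [|lra]; replace (x ^ 2 + y ^ 2)%R with (r * r)%R by (rewrite e; ring).
  field; lra. }
(* ln |z| + i t, with t an argument of z *)
exists (ln r, t); unfold Cexp; cbn; rewrite hc, hs, exp_ln; auto.
f_equal; field; lra.
Qed.

Lemma powerRZ_m1_sq n : (powerRZ (-1) n * powerRZ (-1) n = 1)%R.
Proof.
pattern n; apply Z.peano_ind; [cbn; ring| |]; clear n; intros n hn.
- unfold Z.succ; rewrite powerRZ_add by lra.
  rewrite powerRZ_1; lra.
- unfold Z.pred; rewrite powerRZ_add by lra.
  replace (powerRZ (-1) (-1)) with (-1)%R; [lra|].
  change (-1 = / (-1 * 1))%R; field.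
Qed.

Lemma Csign_even n m : Csign (n + 2 * m) = Csign n.
Proof.
unfold Csign; replace (n + 2 * m) with (n + (m + m)) by lia.
rewrite 2!powerRZ_add, powerRZ_m1_sq by lra; f_equal; ring.
Qed.

Lemma Csign_succ n : Csign (n + 1) = (- Csign n)%C.
Proof.
unfold Csign; rewrite powerRZ_add by lra; rewrite powerRZ_1, <- RtoC_opp; f_equal; ring.
Qed.

Lemma Csign_odd n m : Csign (n + (2 * m + 1)) = (- Csign n)%C.
Proof.
replace (n + (2 * m + 1)) with ((n + 1) + 2 * m) by lia.
now rewrite Csign_even, Csign_succ.
Qed.

(** * Second order multiplicative recurrences *)

Lemma Cmult_eq_cancel_l a b c : a <> RtoC 0 -> (a * b = a * c)%C -> b = c.
Proof.
intros ha h.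
replace b with (/ a * (a * b))%C by (field; auto).
rewrite h; field; auto.
Qed.

Lemma Cmult_eq_cancel_r a b c : a <> RtoC 0 -> (b * a = c * a)%C -> b = c.
Proof.
intros ha h; apply (Cmult_eq_cancel_l a); auto; rewrite 2!(Cmult_comm a); auto.
Qed.

(** Since no term vanishes, the recurrence determines each term from the two
    preceding ones and also from the two following ones. *)
Lemma recurrence_unique (p q r : Z -> C) :
  (forall n, p n <> RtoC 0) -> (forall n, q n <> RtoC 0) ->
  (forall n, p (n + 1)%Z * p (n - 1)%Z = r n * p n ^ 2)%C ->
  (forall n, q (n + 1)%Z * q (n - 1)%Z = r n * q n ^ 2)%C ->
  p 0 = q 0 -> p 1 = q 1 -> forall n, p n = q n.
Proof.
intros hp hq rp rq e0 e1.
enough (h : forall n, p n = q n /\ p (n + 1) = q (n + 1)) by apply h.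
apply Z.peano_ind.
- auto.
- intros n [h1 h2]; unfold Z.succ; split; auto.
  generalize (rp (n + 1)) (rq (n + 1)).
  replace (n + 1 - 1) with n by lia; rewrite h1, h2; intros h3 h4.
  apply (Cmult_eq_cancel_r (q n)); auto; congruence.
- intros n [h1 h2]; unfold Z.pred; replace (n + -1) with (n - 1) by lia.
  replace (n - 1 + 1) with n by lia; split; auto.
  generalize (rp n) (rq n); rewrite h1, h2; intros h3 h4.
  apply (Cmult_eq_cancel_l (q (n + 1))); auto; congruence.
Qed.

Lemma RtoC_2 : RtoC 2 = (RtoC 1 + RtoC 1)%C.
Proof. rewrite <- RtoC_plus; f_equal; ring. Qed.

Lemma RtoC_4 : RtoC 4 = (RtoC 2 + RtoC 2)%C.
Proof. rewrite <- RtoC_plus; f_equal; ring. Qed.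

Lemma IZR_C_neq_0 n : n <> 0 -> RtoC (IZR n) <> RtoC 0.
Proof. intros h e; apply RtoC_inj in e; apply h, eq_IZR, e. Qed.

(** The prescribed second difference is that of c1 u^2 + c2 (-1)^u along steps of
    odd length g.  What is left of log f is affine, so c3 and c4 are obtained
    from its values m0 and m1 at a and a + g; then [recurrence_unique] applies. *)
Lemma quadratic_exponential (f : Z -> C) a g t (c1 c2 : C) :
  0 < g -> g = 2 * t + 1 -> (forall u, coset a g u -> f u <> RtoC 0) ->
  (forall u, coset a g u -> f (u + g)%Z * f (u - g)%Z
     = Cexp (RtoC 2 * c1 * RtoC (IZR g) ^ 2 - RtoC 4 * c2 * Csign u) * f u ^ 2)%C ->
  exists c3 c4, forall u, coset a g u ->
    f u = Cexp (c1 * RtoC (IZR u) ^ 2 + c2 * Csign u + c3 * RtoC (IZR u) + c4)%C.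
Proof.
intros hg og hf hr.
assert (ha : coset a g a) by (exists 0; lia).
assert (hag : coset a g (a + g)) by (exists 1; lia).
assert (ng : RtoC (IZR g) <> RtoC 0) by (apply IZR_C_neq_0; lia).
destruct (Cexp_surjective (f a) (hf _ ha)) as [l0 e0].
destruct (Cexp_surjective (f (a + g)) (hf _ hag)) as [l1 e1].
set (m0 := (l0 - c1 * RtoC (IZR a) ^ 2 - c2 * Csign a)%C).
set (m1 := (l1 - c1 * RtoC (IZR (a + g)%Z) ^ 2 - c2 * Csign (a + g)%Z)%C).
set (c3 := ((m1 - m0) / RtoC (IZR g))%C).
set (c4 := (m0 - c3 * RtoC (IZR a))%C).
exists c3, c4.
intros u [n ->].
apply (recurrence_unique (fun n => f (a + g * n))
  (fun n => Cexp (c1 * RtoC (IZR (a + g * n)%Z) ^ 2 + c2 * Csign (a + g * n)%Z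
                  + c3 * RtoC (IZR (a + g * n)%Z) + c4))%C
  (fun n => Cexp (RtoC 2 * c1 * RtoC (IZR g) ^ 2
                  - RtoC 4 * c2 * Csign (a + g * n)%Z))%C).
- intros k; apply hf; exists k; auto.
- intros k; apply Cexp_neq_0.
- intros k; rewrite <- hr by (exists k; auto).
  f_equal; f_equal; lia.
- intros k; set (u := a + g * k).
  replace (a + g * (k + 1)) with (u + g) by (unfold u; lia).
  replace (a + g * (k - 1)) with (u - g) by (unfold u; lia).
  rewrite Cexp_sq, <- !Cexp_plus; f_equal.
  assert (s1 : Csign (u + g) = (- Csign u)%C).
  { rewrite og; apply Csign_odd. }
  assert (s2 : Csign (u - g) = (- Csign u)%C).
  { replace (u - g) with (u + (2 * (- t - 1) + 1)) by lia; apply Csign_odd. }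
  rewrite s1, s2, plus_IZR, minus_IZR, RtoC_plus, RtoC_minus, RtoC_4, RtoC_2; ring.
- cbn beta; replace (a + g * 0) with a by lia; rewrite <- e0; f_equal.
  unfold c4, m0; ring.
- cbn beta; replace (a + g * 1) with (a + g) by lia; rewrite <- e1; f_equal.
  unfold c4, c3.
  transitivity (c1 * RtoC (IZR (a + g)%Z) ^ 2 + c2 * Csign (a + g)%Z + m1)%C.
  + unfold m1; ring.
  + rewrite plus_IZR, RtoC_plus; field; auto.
Qed.

(** * The functional equation *)

Definition satisfies (f1 f2 : Z -> C) : Prop := forall u u' v v',
  (f1 (u + v)%Z * f2 (u - v)%Z * f1 (u' + v')%Z * f2 (u' - v')%Z
   = f1 (u + v')%Z * f2 (u - v')%Z * f1 (u' + v)%Z * f2 (u' - v)%Z)%C.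

Lemma satisfies_sym f1 f2 : satisfies f1 f2 -> satisfies f2 f1.
Proof.
intros h u u' v v'; generalize (h u u' (- v) (- v')).
unfold Z.sub; rewrite !Z.opp_involutive; intros e.
transitivity (f1 (u + - v)%Z * f2 (u + v)%Z * f1 (u' + - v')%Z * f2 (u' + v')%Z)%C;
  [ring|rewrite e; ring].
Qed.

Lemma Cmult_neq_0_inv a b : (a * b)%C <> RtoC 0 -> a <> RtoC 0 /\ b <> RtoC 0.
Proof.
intros h; split; intros e; apply h; rewrite e; ring.
Qed.

(** Exchanging v and v' exchanges the two sides, so if one side is nonzero the
    hypothesis applies, and otherwise both vanish. *)
Lemma satisfies_on_supp f1 f2 :
  (forall u u' v v', supp f1 (u + v) -> supp f2 (u - v) ->
     supp f1 (u' + v') -> supp f2 (u' - v') ->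
     (f1 (u + v)%Z * f2 (u - v)%Z * f1 (u' + v')%Z * f2 (u' - v')%Z
      = f1 (u + v')%Z * f2 (u - v')%Z * f1 (u' + v)%Z * f2 (u' - v)%Z)%C) ->
  satisfies f1 f2.
Proof.
intros h.
assert (h' : forall u u' v v',
  (f1 (u + v)%Z * f2 (u - v)%Z * f1 (u' + v')%Z * f2 (u' - v')%Z)%C <> RtoC 0 ->
  (f1 (u + v)%Z * f2 (u - v)%Z * f1 (u' + v')%Z * f2 (u' - v')%Z
   = f1 (u + v')%Z * f2 (u - v')%Z * f1 (u' + v)%Z * f2 (u' - v)%Z)%C).
{ intros u u' v v' n.
  apply Cmult_neq_0_inv in n; destruct n as [n n4].
  apply Cmult_neq_0_inv in n; destruct n as [n n3].
  apply Cmult_neq_0_inv in n; destruct n as [n1 n2].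
  apply h; auto. }
intros u u' v v'.
destruct (Ceq_dec (f1 (u + v)%Z * f2 (u - v)%Z * f1 (u' + v')%Z * f2 (u' - v')%Z)
  (RtoC 0)) as [e1|n1]; [|auto].
destruct (Ceq_dec (f1 (u + v')%Z * f2 (u - v')%Z * f1 (u' + v)%Z * f2 (u' - v)%Z)
  (RtoC 0)) as [e2|n2]; [congruence|].
symmetry; auto.
Qed.

Lemma satisfies_exchange f1 f2 : satisfies f1 f2 -> exchange (supp f1) (supp f2).
Proof.
intros h u u' v v' h1 h2 h3 h4.
assert (n : (f1 (u + v')%Z * f2 (u - v')%Z * f1 (u' + v)%Z * f2 (u' - v)%Z)%C
            <> RtoC 0).
{ rewrite <- h; repeat apply Cmult_neq_0; auto. }
apply Cmult_neq_0_inv in n; destruct n as [n _].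
apply Cmult_neq_0_inv in n; destruct n as [n _].
apply Cmult_neq_0_inv in n; exact n.
Qed.

(** The minor on the four points (x, y - k), (x, y + k), (x - k, y), (x + k, y),
    which in the coordinates (u,v) form a rectangle. *)
Lemma satisfies_cross f1 f2 x y k s t : satisfies f1 f2 ->
  k = 1 + 2 * s -> x + y = 1 + 2 * t ->
  (f1 x ^ 2 * f2 (y - k)%Z * f2 (y + k)%Z
   = f2 y ^ 2 * f1 (x - k)%Z * f1 (x + k)%Z)%C.
Proof.
intros h ek e.
generalize (h (t + s + 1) (t - s) (x - (t + s + 1)) (x - (t - s))).
replace (t + s + 1 + (x - (t + s + 1))) with x by lia.
replace (t + s + 1 - (x - (t + s + 1))) with (y + k) by lia.
replace (t - s + (x - (t - s))) with x by lia.
replace (t - s - (x - (t - s))) with (y - k) by lia.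
replace (t + s + 1 + (x - (t - s))) with (x + k) by lia.
replace (t + s + 1 - (x - (t - s))) with y by lia.
replace (t - s + (x - (t + s + 1))) with (x - k) by lia.
replace (t - s - (x - (t + s + 1))) with y by lia.
intros h1; transitivity (f1 x * f2 (y + k)%Z * f1 x * f2 (y - k)%Z)%C;
  [ring|rewrite h1; ring].
Qed.

(** * Values on cosets *)

Lemma Csign_sq n : (Csign n * Csign n)%C = RtoC 1.
Proof. unfold Csign; rewrite <- RtoC_mult, powerRZ_m1_sq; auto. Qed.

Lemma supp_coset_neq_0 f a g : (forall u, supp f u <-> coset a g u) ->
  forall u, coset a g u -> f u <> RtoC 0.
Proof. intros h u; apply h. Qed.

Lemma coset_translate a g u : coset a g u -> coset a g (u + g) /\ coset a g (u - g).
Proof. intros [n ->]; split; [exists (n + 1)|exists (n - 1)]; lia. Qed.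

Definition ratio (f : Z -> C) (g u : Z) : C :=
  (f (u + g)%Z * f (u - g)%Z / f u ^ 2)%C.

Lemma ratio_spec f g u : f u <> RtoC 0 ->
  (f (u + g)%Z * f (u - g)%Z = ratio f g u * f u ^ 2)%C.
Proof. intros h; unfold ratio; field; auto. Qed.

Lemma ratio_neq_0 f a g u : (forall u, supp f u <-> coset a g u) ->
  coset a g u -> ratio f g u <> RtoC 0.
Proof.
intros h hu e.
assert (H := supp_coset_neq_0 f a g h).
destruct (coset_translate a g u hu) as [h1 h2].
apply (Cmult_neq_0 (f (u + g)) (f (u - g))); auto.
rewrite ratio_spec, e by auto; ring.
Qed.

Lemma ratio_opposite_parity f1 f2 g t x y s : satisfies f1 f2 -> g = 1 + 2 * t ->
  f1 x <> RtoC 0 -> f2 y <> RtoC 0 -> x + y = 1 + 2 * s ->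
  ratio f1 g x = ratio f2 g y.
Proof.
intros h og hx hy e.
assert (E := satisfies_cross f1 f2 x y g t s h og e).
unfold ratio.
transitivity ((f2 y ^ 2 * f1 (x - g)%Z * f1 (x + g)%Z) / (f1 x ^ 2 * f2 y ^ 2))%C;
  [field; auto|].
rewrite <- E; field; auto.
Qed.

(** Let exp la and exp lb be the second differences of f1 at a1 and of f2 at a2.
    By [ratio_opposite_parity], f1 has exp la at the parity of a1 and exp lb at
    the other one, and f2 the other way round.  Solving
    2 c1 g^2 - 4 c2 (-1)^u = la or lb accordingly gives c1 = (la + lb) / (4 g^2)
    and c2 = (-1)^a1 (lb - la) / 8, and for f2 the same c1 and the opposite of
    c2. *)
Lemma exponential_on_cosets f1 f2 a1 a2 g t s : satisfies f1 f2 ->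
  0 < g -> g = 1 + 2 * t -> a1 + a2 = 2 * s ->
  (forall u, supp f1 u <-> coset a1 g u) -> (forall u, supp f2 u <-> coset a2 g u) ->
  exists c1 c2 c3 c4 c5 c6 : C,
    (forall u, coset a1 g u ->
       f1 u = Cexp (c1 * RtoC (IZR u) ^ 2 + c2 * Csign u + c3 * RtoC (IZR u) + c4)%C) /\
    (forall u, coset a2 g u ->
       f2 u = Cexp (c1 * RtoC (IZR u) ^ 2 - c2 * Csign u + c5 * RtoC (IZR u) + c6)%C).
Proof.
intros h hg og ea S1 S2.
assert (n1 := supp_coset_neq_0 f1 a1 g S1).
assert (n2 := supp_coset_neq_0 f2 a2 g S2).
assert (ha1 : coset a1 g a1) by (exists 0; lia).
assert (ha2 : coset a2 g a2) by (exists 0; lia).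
assert (ha1' := proj1 (coset_translate a1 g a1 ha1)).
assert (ha2' := proj1 (coset_translate a2 g a2 ha2)).
destruct (Cexp_surjective (ratio f1 g a1)) as [la ela].
{ apply ratio_neq_0 with a1; auto. }
destruct (Cexp_surjective (ratio f2 g a2)) as [lb elb].
{ apply ratio_neq_0 with a2; auto. }
assert (r1 : forall x m, coset a1 g x -> x = a1 + 2 * m -> ratio f1 g x = Cexp la).
{ intros x m hx e; rewrite ela.
  transitivity (ratio f2 g (a2 + g)).
  - apply (ratio_opposite_parity f1 f2 g t _ _ (s + m + t)); auto; lia.
  - symmetry; apply (ratio_opposite_parity f1 f2 g t _ _ (s + t)); auto; lia. }
assert (r1' : forall x m, coset a1 g x -> x = a1 + (2 * m + 1) ->
  ratio f1 g x = Cexp lb).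
{ intros x m hx e; rewrite elb.
  apply (ratio_opposite_parity f1 f2 g t _ _ (s + m)); auto; lia. }
assert (r2 : forall y m, coset a2 g y -> y = a1 + 2 * m -> ratio f2 g y = Cexp lb).
{ intros y m hy e; rewrite <- (r1' (a1 + g) t) by (auto; lia).
  symmetry; apply (ratio_opposite_parity f1 f2 g t _ _ (a1 + m + t)); auto; lia. }
assert (r2' : forall y m, coset a2 g y -> y = a1 + (2 * m + 1) ->
  ratio f2 g y = Cexp la).
{ intros y m hy e; rewrite ela.
  symmetry; apply (ratio_opposite_parity f1 f2 g t _ _ (a1 + m)); auto; lia. }
assert (ng : RtoC (IZR g) <> RtoC 0) by (apply IZR_C_neq_0; lia).
assert (ntwo : RtoC 2 <> RtoC 0) by (intros E; apply RtoC_inj in E; lra).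
set (G := RtoC (IZR g)) in *.
set (S := Csign a1).
set (c1 := ((la + lb) / (RtoC 2 * RtoC 2 * G ^ 2))%C).
set (c2 := (S * (lb - la) / (RtoC 2 * RtoC 2 * RtoC 2))%C).
assert (E4 : RtoC 4 = (RtoC 2 * RtoC 2)%C) by (rewrite <- RtoC_mult; f_equal; lra).
assert (SS : (S * S)%C = RtoC 1) by apply Csign_sq.
assert (Ea : (RtoC 2 * c1 * G ^ 2 - RtoC 4 * c2 * S)%C = la).
{ transitivity ((la + lb) / RtoC 2 - S * S * (lb - la) / RtoC 2)%C.
  - rewrite E4; unfold c1, c2; field; auto.
  - rewrite SS; transitivity ((RtoC 1 + RtoC 1) / RtoC 2 * la)%C; [field; auto|].
    rewrite <- RtoC_2; field; auto. }
assert (Eb : (RtoC 2 * c1 * G ^ 2 + RtoC 4 * c2 * S)%C = lb).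
{ transitivity ((la + lb) / RtoC 2 + S * S * (lb - la) / RtoC 2)%C.
  - rewrite E4; unfold c1, c2; field; auto.
  - rewrite SS; transitivity ((RtoC 1 + RtoC 1) / RtoC 2 * lb)%C; [field; auto|].
    rewrite <- RtoC_2; field; auto. }
clearbody c1 c2.
destruct (quadratic_exponential f1 a1 g t c1 c2) as (c3 & c4 & h1); auto; [lia| |].
{ intros u hu; rewrite ratio_spec by auto; f_equal; fold G.
  destruct (Z.Even_or_Odd (u - a1)) as [[m e]|[m e]].
  - rewrite (r1 u m) by (auto; lia).
    replace u with (a1 + 2 * m) by lia; rewrite Csign_even; fold S.
    now rewrite Ea.
  - rewrite (r1' u m) by (auto; lia).
    replace u with (a1 + (2 * m + 1)) by lia; rewrite Csign_odd; fold S.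
    f_equal; rewrite <- Eb; ring. }
destruct (quadratic_exponential f2 a2 g t c1 (- c2)) as (c5 & c6 & h2); auto; [lia| |].
{ intros u hu; rewrite ratio_spec by auto; f_equal; fold G.
  destruct (Z.Even_or_Odd (u - a1)) as [[m e]|[m e]].
  - rewrite (r2 u m) by (auto; lia).
    replace u with (a1 + 2 * m) by lia; rewrite Csign_even; fold S.
    f_equal; rewrite <- Eb; ring.
  - rewrite (r2' u m) by (auto; lia).
    replace u with (a1 + (2 * m + 1)) by lia; rewrite Csign_odd; fold S.
    f_equal; rewrite <- Ea; ring. }
exists c1, c2, c3, c4, c5, c6; split; auto.
intros u hu; rewrite h2 by auto; f_equal; ring.
Qed.

(** * Sufficiency of the conditions *)

Lemma satisfies_of_singletons f1 f2 a :
  Same_set Z (supp f1) (Singleton Z a) ->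
  cardinal Z (Intersection Z (supp f2) (coset a 2)) 1 -> satisfies f1 f2.
Proof.
intros [h1 _] hc.
assert (hb : exists b, forall y n, supp f2 y -> y = a + 2 * n -> y = b).
{ inversion hc as [|A n hA b nb eA en]; subst.
  inversion hA; subst.
  exists b; intros y n hy e.
  assert (hy' : In Z (Intersection Z (supp f2) (coset a 2)) y)
    by (split; [exact hy|exists n; exact e]).
  rewrite <- eA in hy'; destruct hy' as [y hy'|y hy']; destruct hy'; auto. }
destruct hb as [b hb].
assert (h1' : forall x, supp f1 x -> x = a).
{ intros x hx; apply h1 in hx; destruct hx; auto. }
apply satisfies_on_supp; intros u u' v v' k1 k2 k3 k4.
assert (e1 := h1' _ k1); assert (e3 := h1' _ k3).
assert (e2 := hb _ (- v) k2 ltac:(lia)); assert (e4 := hb _ (- v') k4 ltac:(lia)).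
assert (u = u') by lia; assert (v = v') by lia; subst; ring.
Qed.

Lemma satisfies_of_opposite_parities f1 f2 a :
  Included Z (supp f1) (coset a 2) -> Included Z (supp f2) (coset (a + 1) 2) ->
  satisfies f1 f2.
Proof.
intros h1 h2; apply satisfies_on_supp; intros u u' v v' k1 k2 _ _.
apply h1 in k1; apply h2 in k2; destruct k1, k2; lia.
Qed.

(** By parity, F can be nonzero only at the four points with
    2u = a1 + a2 + i k and 2v = a1 - a2 + j k, where i, j = 1 or -1.  Two of them
    sharing u or v give a trivial equation, and the two diagonals give the
    hypothesis on the values. *)
Lemma satisfies_of_triples f1 f2 a1 a2 k :
  coset 1 2 k -> coset 1 2 (a1 + a2) ->
  Included Z (supp f1) (Triple Z a1 (a1 - k) (a1 + k)) ->
  Included Z (supp f2) (Triple Z a2 (a2 - k) (a2 + k)) ->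
  (f1 a1 ^ 2 * f2 (a2 - k)%Z * f2 (a2 + k)%Z
   = f2 a2 ^ 2 * f1 (a1 - k)%Z * f1 (a1 + k)%Z)%C -> satisfies f1 f2.
Proof.
intros [m ek] [n ea] h1 h2 E.
assert (T : forall u v, supp f1 (u + v) -> supp f2 (u - v) ->
  exists i j, (i = 1 \/ i = -1) /\ (j = 1 \/ j = -1) /\
    2 * u = a1 + a2 + i * k /\ 2 * v = a1 - a2 + j * k).
{ intros u v hx hy; apply h1 in hx; apply h2 in hy.
  inversion hx as [e1|e1|e1]; inversion hy as [e2|e2|e2]; try lia;
    [exists (-1), 1 | exists 1, (-1) | exists (-1), (-1) | exists 1, 1]; lia. }
apply satisfies_on_supp; intros u u' v v' k1 k2 k3 k4.
destruct (T u v k1 k2) as (i & j & hi & hj & eu & ev).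
destruct (T u' v' k3 k4) as (i' & j' & hi' & hj' & eu' & ev').
destruct (Z.eq_dec u u') as [->|nu]; [ring|].
destruct (Z.eq_dec v v') as [->|nv]; [ring|].
assert (i' = - i) by (destruct hi as [-> | ->], hi' as [-> | ->]; lia).
assert (j' = - j) by (destruct hj as [-> | ->], hj' as [-> | ->]; lia).
subst i' j'.
destruct hi as [-> | ->], hj as [-> | ->].
- replace (u + v) with (a1 + k) by lia; replace (u - v) with a2 by lia.
  replace (u' + v') with (a1 - k) by lia; replace (u' - v') with a2 by lia.
  replace (u + v') with a1 by lia; replace (u - v') with (a2 + k) by lia.
  replace (u' + v) with a1 by lia; replace (u' - v) with (a2 - k) by lia.
  transitivity (f2 a2 ^ 2 * f1 (a1 - k)%Z * f1 (a1 + k)%Z)%C; [ring|].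
  rewrite <- E; ring.
- replace (u + v) with a1 by lia; replace (u - v) with (a2 + k) by lia.
  replace (u' + v') with a1 by lia; replace (u' - v') with (a2 - k) by lia.
  replace (u + v') with (a1 + k) by lia; replace (u - v') with a2 by lia.
  replace (u' + v) with (a1 - k) by lia; replace (u' - v) with a2 by lia.
  transitivity (f1 a1 ^ 2 * f2 (a2 - k)%Z * f2 (a2 + k)%Z)%C; [ring|].
  rewrite E; ring.
- replace (u + v) with a1 by lia; replace (u - v) with (a2 - k) by lia.
  replace (u' + v') with a1 by lia; replace (u' - v') with (a2 + k) by lia.
  replace (u + v') with (a1 - k) by lia; replace (u - v') with a2 by lia.
  replace (u' + v) with (a1 + k) by lia; replace (u' - v) with a2 by lia.
  transitivity (f1 a1 ^ 2 * f2 (a2 - k)%Z * f2 (a2 + k)%Z)%C; [ring|].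
  rewrite E; ring.
- replace (u + v) with (a1 - k) by lia; replace (u - v) with a2 by lia.
  replace (u' + v') with (a1 + k) by lia; replace (u' - v') with a2 by lia.
  replace (u + v') with a1 by lia; replace (u - v') with (a2 - k) by lia.
  replace (u' + v) with a1 by lia; replace (u' - v) with (a2 + k) by lia.
  transitivity (f2 a2 ^ 2 * f1 (a1 - k)%Z * f1 (a1 + k)%Z)%C; [ring|].
  rewrite <- E; ring.
Qed.

(** As k is odd, 2 is invertible mod k, so membership in the two cosets amounts
    to separate congruences for u and for v mod k. *)
Lemma coset_exchange a1 a2 k : coset 1 2 k ->
  exchange (coset a1 k) (coset a2 k).
Proof.
intros [t ek] u u' v v' [n1 e1] [n2 e2] [n3 e3] [n4 e4].
assert (hj : exists j, n1 + n2 + n3 - n4 = 2 * j).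
{ destruct (Z.Even_or_Odd (n1 + n2 + n3 - n4)) as [h|[j ej]]; [exact h|].
  exfalso.
  assert (2 * (u + v') = 2 * a1 + k * (2 * j + 1)) by (rewrite <- ej; lia).
  rewrite ek in *; lia. }
destruct hj as [j ej].
assert (E : 2 * (u + v') = 2 * a1 + k * (2 * j)) by (rewrite <- ej; lia).
split; [exists j; lia|].
exists (n1 + n2 - j); lia.
Qed.

(** As u + v and u - v have the same parity, the sign terms cancel in F(u,v), and
    (u+v)^2 + (u-v)^2 = 2 u^2 + 2 v^2, so the exponent is a function of u plus a
    function of v. *)
Lemma satisfies_of_exponentials f1 f2 (c1 c2 c3 c4 c5 c6 : C) k a1 a2 :
  coset 1 2 k ->
  (forall u : Z,
     (In Z (coset a1 k) u ->
        f1 u = Cexp (c1 * RtoC (IZR u) ^ 2 + c2 * Csign u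
                     + c3 * RtoC (IZR u) + c4)%C) /\
     (~ In Z (coset a1 k) u -> f1 u = RtoC 0)) ->
  (forall u : Z,
     (In Z (coset a2 k) u ->
        f2 u = Cexp (c1 * RtoC (IZR u) ^ 2 - c2 * Csign u
                     + c5 * RtoC (IZR u) + c6)%C) /\
     (~ In Z (coset a2 k) u -> f2 u = RtoC 0)) ->
  satisfies f1 f2.
Proof.
intros hk h1 h2.
assert (s1 : forall u, supp f1 u -> coset a1 k u).
{ intros u hu; destruct (classic (coset a1 k u)) as [|n]; auto.
  exfalso; apply hu, (h1 u), n. }
assert (s2 : forall u, supp f2 u -> coset a2 k u).
{ intros u hu; destruct (classic (coset a2 k u)) as [|n]; auto.
  exfalso; apply hu, (h2 u), n. }
assert (P : forall u v, coset a1 k (u + v) -> coset a2 k (u - v) ->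
  (f1 (u + v)%Z * f2 (u - v)%Z)%C =
  Cexp ((c1 + c1) * (RtoC (IZR u) ^ 2 + RtoC (IZR v) ^ 2)
        + (c3 + c5) * RtoC (IZR u) + (c3 - c5) * RtoC (IZR v) + c4 + c6)%C).
{ intros u v hx hy.
  rewrite (proj1 (h1 _) hx), (proj1 (h2 _) hy), <- Cexp_plus; f_equal.
  replace (Csign (u + v)) with (Csign (u - v)).
  - rewrite plus_IZR, minus_IZR, RtoC_plus, RtoC_minus; ring.
  - replace (u + v) with (u - v + 2 * v) by lia; now rewrite Csign_even. }
apply satisfies_on_supp; intros u u' v v' k1 k2 k3 k4.
apply s1 in k1; apply s2 in k2; apply s1 in k3; apply s2 in k4.
assert (X := coset_exchange a1 a2 k hk).
destruct (X u u' v v') as [k5 k6]; auto.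
destruct (X u' u v' v) as [k7 k8]; auto.
transitivity ((f1 (u + v)%Z * f2 (u - v)%Z) * (f1 (u' + v')%Z * f2 (u' - v')%Z))%C;
  [ring|].
transitivity ((f1 (u + v')%Z * f2 (u - v')%Z) * (f1 (u' + v)%Z * f2 (u' - v)%Z))%C;
  [|ring].
rewrite !P by auto; rewrite <- !Cexp_plus; f_equal; ring.
Qed.

(** * The classification *)

Lemma singleton_and_single_point A B a y r :
  exchange A B -> A a -> B y -> a - y = 2 * r ->
  (forall x, A x -> x = a) ->
  Same_set Z A (Singleton Z a) /\ cardinal Z (Intersection Z B (coset a 2)) 1.
Proof.
intros H ha hy e hA; split.
- split; intros x hx; [apply hA in hx; subst; constructor|destruct hx; exact ha].
- replace (Intersection Z B (coset a 2)) with (Add Z (Empty_set Z) y).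
  + apply card_add; [apply card_empty|intros []].
  + apply Extensionality_Ensembles; split.
    * intros z [z' []|z' []]; split; [exact hy|exists (- r); lia].
    * intros z [z' hz [n en]]; right.
      assert (hz' : B (y + 2 * (n + r))) by (unfold In in hz; same_point hz).
      destruct (exchange_midpoint A B a y (n + r) r) as (h1 & _); auto.
      apply hA in h1; replace z' with y by lia; constructor.
Qed.

(** The first five alternatives leave two supports with at least two points each
    and with a pair of points of equal parity, which is the setting of
    [exchange_structure]. *)
Lemma classification f1 f2 : satisfies f1 f2 ->
    (forall u : Z, f1 u = RtoC 0)
    \/
    (forall u : Z, f2 u = RtoC 0)
    \/
    (exists a : Z,
       Same_set Z (supp f1) (Singleton Z a) /\
       cardinal Z (Intersection Z (supp f2) (coset a 2)) 1)
    \/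
    (exists a : Z,
       Same_set Z (supp f2) (Singleton Z a) /\
       cardinal Z (Intersection Z (supp f1) (coset a 2)) 1)
    \/
    (exists a : Z,
       Included Z (supp f1) (coset a 2) /\
       Included Z (supp f2) (coset (a + 1) 2))
    \/
    (exists g, 0 < g /\ coset 1 2 g /\ triples_or_cosets (supp f1) (supp f2) g).
Proof.
intros h; assert (H := satisfies_exchange f1 f2 h).
destruct (classic (exists x, supp f1 x)) as [[x0 hx0]|N].
2:{ left; intros u; apply NNPP; intros e; apply N; exists u; exact e. }
destruct (classic (exists y, supp f2 y)) as [[y0 hy0]|N].
2:{ right; left; intros u; apply NNPP; intros e; apply N; exists u; exact e. }
right; right.
destruct (classic (exists x y r, supp f1 x /\ supp f2 y /\ x - y = 2 * r))
  as [(x & y & r & hx & hy & e)|N].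
2:{ right; right; left; exists x0.
  assert (odd : forall x y, supp f1 x -> supp f2 y -> exists n, y - x = 2 * n + 1).
  { intros x y hx hy; destruct (Z.Even_or_Odd (y - x)) as [[n en]|on]; [|exact on].
    exfalso; apply N; exists x, y, (- n); repeat split; auto; lia. }
  destruct (odd x0 y0 hx0 hy0) as [n0 e0].
  split; intros z hz.
  - destruct (odd z y0 hz hy0) as [n e]; exists (n0 - n); lia.
  - destruct (odd x0 z hx0 hz) as [n e]; exists n; lia. }
destruct (classic (exists x', supp f1 x' /\ x' <> x)) as [(x' & hx' & nx)|N].
2:{ left; exists x; apply (singleton_and_single_point _ _ x y r); auto.
  intros z hz; apply NNPP; intros nz; apply N; exists z; auto. }
destruct (classic (exists y', supp f2 y' /\ y' <> y)) as [(y' & hy' & ny)|N].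
2:{ right; left; exists y; apply (singleton_and_single_point _ _ y x (- r));
    auto using exchange_sym; try lia.
  intros z hz; apply NNPP; intros nz; apply N; exists z; auto. }
right; right; right.
apply (exchange_structure (supp f1) (supp f2) x y r x' y'); auto.
Qed.

Local Close Scope Z_scope.

Theorem theorem1p1 : forall f1 f2 : Z -> C,
  (forall u u' v v' : Z,
     (f1 (u + v)%Z * f2 (u - v)%Z * f1 (u' + v')%Z * f2 (u' - v')%Z
      = f1 (u + v')%Z * f2 (u - v')%Z * f1 (u' + v)%Z * f2 (u' - v)%Z)%C)
  <->
  (
    (forall u : Z, f1 u = RtoC 0)
    \/
    (forall u : Z, f2 u = RtoC 0)
    \/
    (exists a : Z,
       Same_set Z (supp f1) (Singleton Z a) /\
       cardinal Z (Intersection Z (supp f2) (coset a 2)) 1)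
    \/
    (exists a : Z,
       Same_set Z (supp f2) (Singleton Z a) /\
       cardinal Z (Intersection Z (supp f1) (coset a 2)) 1)
    \/
    (exists a : Z,
       Included Z (supp f1) (coset a 2) /\
       Included Z (supp f2) (coset (a + 1) 2))
    \/
    (exists a1 a2 k : Z,
       In Z (coset 1 2) k /\
       In Z (coset 1 2) (a1 + a2)%Z /\
       Included Z (supp f1) (Triple Z a1 (a1 - k)%Z (a1 + k)%Z) /\
       Included Z (supp f2) (Triple Z a2 (a2 - k)%Z (a2 + k)%Z) /\
       (f1 a1 ^ 2 * f2 (a2 - k)%Z * f2 (a2 + k)%Z
        = f2 a2 ^ 2 * f1 (a1 - k)%Z * f1 (a1 + k)%Z)%C)
    \/
    (exists (c1 c2 c3 c4 c5 c6 : C) (k a1 a2 : Z),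
       (0 < k)%Z /\
       In Z (coset 1 2) k /\
       In Z (coset 0 2) (a1 + a2)%Z /\
       (forall u : Z,
          (In Z (coset a1 k) u ->
             f1 u = Cexp (c1 * RtoC (IZR u) ^ 2 + c2 * Csign u
                          + c3 * RtoC (IZR u) + c4)%C) /\
          (~ In Z (coset a1 k) u -> f1 u = RtoC 0)) /\
       (forall u : Z,
          (In Z (coset a2 k) u ->
             f2 u = Cexp (c1 * RtoC (IZR u) ^ 2 - c2 * Csign u
                          + c5 * RtoC (IZR u) + c6)%C) /\
          (~ In Z (coset a2 k) u -> f2 u = RtoC 0)))).
Proof.
intros f1 f2; split.
- intros h.
  destruct (classification f1 f2 h)
    as [c|[c|[c|[c|[c|(g & hg & [t og] & a1 & a2 & D)]]]]]; [tauto..|].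
  do 5 right.
  destruct D as [([s e] & i1 & i2)|([s e] & i1 & i2)]; [left|right].
  + exists a1, a2, g; split; [exists t; auto|].
    split; [exists s; lia|]; do 2 (split; [assumption|]).
    apply (satisfies_cross f1 f2 a1 a2 g t s); auto; lia.
  + destruct (exponential_on_cosets f1 f2 a1 a2 g t s)
      as (c1 & c2 & c3 & c4 & c5 & c6 & E1 & E2); auto.
    exists c1, c2, c3, c4, c5, c6, g, a1, a2.
    split; [exact hg|split; [exists t; exact og|split; [exists s; lia|]]].
    split; intros u; split; auto; intros n; apply NNPP; intros k; apply n;
      [apply i1 | apply i2]; exact k.
- intros c; change (satisfies f1 f2); revert c.
  intros [z|[z|[(a & i & c)|[(a & i & c)|[(a & i1 & i2)|[D|D]]]]]].
  + intros u u' v v'; rewrite !z; ring.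
  + intros u u' v v'; rewrite !z; ring.
  + apply (satisfies_of_singletons f1 f2 a); auto.
  + apply satisfies_sym, (satisfies_of_singletons f2 f1 a); auto.
  + apply (satisfies_of_opposite_parities f1 f2 a); auto.
  + destruct D as (a1 & a2 & k & hk & ha & i1 & i2 & e).
    apply (satisfies_of_triples f1 f2 a1 a2 k); auto.
  + destruct D as (c1 & c2 & c3 & c4 & c5 & c6 & k & a1 & a2 & _ & hk & _ & h1 & h2).
    apply (satisfies_of_exponentials f1 f2 c1 c2 c3 c4 c5 c6 k a1 a2); auto.
Qed.
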